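(* Let $F$ be a field of characteristic zero and let $L$ be a three dimensional Lie algebra over $F$. Then $L$ has a plus-minus pair if and only if $L$ is generated, as a Lie algebra, by two elements. Moreover, if $x$ and $y$ generate $L$, then $(P,M)$ with $P=Fx$ and $M=Fy$ is a plus-minus pair for $L$.
   Context: For a Lie algebra $\mathfrak a$ over $F$, $U(\mathfrak a)$ denotes its universal enveloping algebra; for a subalgebra $\mathfrak b\subseteq\mathfrak a$, $U(\mathfrak b)$ is regarded as a subalgebra of $U(\mathfrak a)$. For subspaces $A,B$ of $U(\mathfrak a)$, $AB$ denotes the linear span of all products $ab$ with $a\in A$, $b\in B$. A Lie algebra $L$ has a plus-minus pair $(P,M)$ if $P,M$ are subalgebras of $L$ with $P+M\neq L$ (vector space sum) and $U(L)=U(P)U(M)U(P)$. *)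

(* Defs.v *)
From HB Require Import structures.
From mathcomp Require Import all_boot all_order all_algebra generic_quotient.
From mathcomp Require Import boolp classical_sets.

Set Implicit Arguments.
Unset Strict Implicit.
Unset Printing Implicit Defensive.

Import GRing.Theory.
Local Open Scope quotient_scope.
Local Open Scope ring_scope.

HB.mixin Record Lmodule_isLie (F : fieldType) L of GRing.Lmodule F L := {
  lie : L -> L -> L;
  lie_linear_l : forall (a : F) (x y z : L),
    lie (a *: x + y) z = a *: lie x z + lie y z;
  lie_linear_r : forall (a : F) (x y z : L),
    lie z (a *: x + y) = a *: lie z x + lie z y;
  liexx : forall x : L, lie x x = 0;
  lie_jacobi : forall x y z : L,
    lie x (lie y z) + lie y (lie z x) + lie z (lie x y) = 0
}.

#[short(type="lieAlgType")]
HB.structure Definition LieAlgebra (F : fieldType) :=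
  { L of GRing.Lmodule F L & Lmodule_isLie F L }.

#[short(type="finLieAlgType")]
HB.structure Definition FinLieAlgebra (F : fieldType) :=
  { L of Vector F L & Lmodule_isLie F L }.

Section LieSubalgebra.
Variables (F : fieldType) (L : finLieAlgType F).

Definition lie_closed (P : {vspace L}) : Prop :=
  forall x y : L, x \in P -> y \in P -> lie x y \in P.

Structure liesub : Type := LieSub {
  liesub_vspace :> {vspace L};
  liesub_closed : lie_closed liesub_vspace
}.

Definition liesub_of (P : liesub) : predArgType := subvs_of P.

Section SubLie.
Variable P : liesub.
HB.instance Definition _ := Vector.copy (liesub_of P) (subvs_of P).

Definition liesub_lie (u v : liesub_of P) : liesub_of P :=
  Subvs (liesub_closed (subvsP u) (subvsP v)).

Fact liesub_lie_linear_l (a : F) (x y z : liesub_of P) :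
  liesub_lie (a *: x + y) z = a *: liesub_lie x z + liesub_lie y z.
Proof. by apply: val_inj; rewrite /= lie_linear_l. Qed.

Fact liesub_lie_linear_r (a : F) (x y z : liesub_of P) :
  liesub_lie z (a *: x + y) = a *: liesub_lie z x + liesub_lie z y.
Proof. by apply: val_inj; rewrite /= lie_linear_r. Qed.

Fact liesub_liexx (x : liesub_of P) : liesub_lie x x = 0.
Proof. by apply: val_inj; rewrite /= liexx. Qed.

Fact liesub_jacobi (x y z : liesub_of P) :
  liesub_lie x (liesub_lie y z) + liesub_lie y (liesub_lie z x)
    + liesub_lie z (liesub_lie x y) = 0.
Proof. by apply: val_inj; rewrite /= lie_jacobi. Qed.

HB.instance Definition _ := Lmodule_isLie.Build F (liesub_of P)
  liesub_lie_linear_l liesub_lie_linear_r liesub_liexx liesub_jacobi.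

End SubLie.

Fact lie_line_closed (x : L) : lie_closed <[x]>%VS.
Proof.
move=> _ _ /vlineP[a ->] /vlineP[b ->].
have lie0 (z : L) : lie 0 z = 0.
  apply: (addrI (lie 0 z)).
  by have := lie_linear_l 1 0 0 z; rewrite !scale1r !addr0 => <-.
have lier0 (z : L) : lie z 0 = 0.
  apply: (addrI (lie z 0)).
  by have := lie_linear_r 1 0 0 z; rewrite !scale1r !addr0 => <-.
have := lie_linear_l a x 0 (b *: x); have := lie_linear_r b x 0 x.
by rewrite !addr0 lie0 lier0 liexx scaler0 !addr0 => -> ->; rewrite scaler0 mem0v.
Qed.

Definition lie_line (x : L) : liesub := LieSub (@lie_line_closed x).

(* The subalgebra generated by X, i.e. the intersection of all the
   subalgebras that contain X, is the whole of L. *)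
Definition lie_generated_by (X : seq L) : Prop :=
  forall S : liesub, {subset X <= (S : {vspace L})} -> (S : {vspace L}) = fullv.

End LieSubalgebra.

(* The universal enveloping algebra, presented as the unital associative
   F-algebra on the generators UGen x (x : L) with the relations: UGen is
   linear and UGen [x, y] = UGen x UGen y - UGen y UGen x. The constructors
   of ueq up to ueq_scaleAr are those of the congruence of the free algebra;
   envel_universal below is the universal property. *)
Section Envel.
Variables (F : fieldType) (L : lieAlgType F).

Inductive uterm : Type :=
| UGen of L | UZero | UOne | UOpp of uterm
| UAdd of uterm & uterm | UMul of uterm & uterm | UScale of F & uterm.

Inductive ueq : uterm -> uterm -> Prop :=
| ueq_refl s : ueq s s
| ueq_sym s t : ueq s t -> ueq t s
| ueq_trans s t u : ueq s t -> ueq t u -> ueq s u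
| ueq_opp s s' : ueq s s' -> ueq (UOpp s) (UOpp s')
| ueq_add s s' t t' : ueq s s' -> ueq t t' -> ueq (UAdd s t) (UAdd s' t')
| ueq_mul s s' t t' : ueq s s' -> ueq t t' -> ueq (UMul s t) (UMul s' t')
| ueq_scale a s s' : ueq s s' -> ueq (UScale a s) (UScale a s')
| ueq_addA s t u : ueq (UAdd s (UAdd t u)) (UAdd (UAdd s t) u)
| ueq_addC s t : ueq (UAdd s t) (UAdd t s)
| ueq_add0 s : ueq (UAdd UZero s) s
| ueq_addN s : ueq (UAdd (UOpp s) s) UZero
| ueq_mulA s t u : ueq (UMul s (UMul t u)) (UMul (UMul s t) u)
| ueq_mul1l s : ueq (UMul UOne s) s
| ueq_mul1r s : ueq (UMul s UOne) s
| ueq_mulDl s t u : ueq (UMul (UAdd s t) u) (UAdd (UMul s u) (UMul t u))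
| ueq_mulDr s t u : ueq (UMul s (UAdd t u)) (UAdd (UMul s t) (UMul s u))
| ueq_scaleA a b s : ueq (UScale a (UScale b s)) (UScale (a * b) s)
| ueq_scale1 s : ueq (UScale 1 s) s
| ueq_scaleDr a s t : ueq (UScale a (UAdd s t)) (UAdd (UScale a s) (UScale a t))
| ueq_scaleDl a b s : ueq (UScale (a + b) s) (UAdd (UScale a s) (UScale b s))
| ueq_scaleAl a s t : ueq (UScale a (UMul s t)) (UMul (UScale a s) t)
| ueq_scaleAr a s t : ueq (UScale a (UMul s t)) (UMul s (UScale a t))
| ueq_gen_linear a x y :
    ueq (UGen (a *: x + y)) (UAdd (UScale a (UGen x)) (UGen y))
| ueq_gen_lie x y :
    ueq (UGen (lie x y))
        (UAdd (UMul (UGen x) (UGen y)) (UOpp (UMul (UGen y) (UGen x)))).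

HB.instance Definition _ := gen_eqMixin uterm.
HB.instance Definition _ := gen_choiceMixin uterm.

Definition ueqb : rel uterm := fun s t => `[< ueq s t >].

Fact ueqb_refl : reflexive ueqb.
Proof. by move=> s; apply/asboolP; apply: ueq_refl. Qed.

Fact ueqb_sym : symmetric ueqb.
Proof. by move=> s t; apply/asboolP/asboolP; apply: ueq_sym. Qed.

Fact ueqb_trans : transitive ueqb.
Proof.
by move=> t s u /asboolP st /asboolP tu; apply/asboolP; apply: ueq_trans st tu.
Qed.

Canonical ueqb_equiv := EquivRel ueqb ueqb_refl ueqb_sym ueqb_trans.

Definition envel : Type := {eq_quot ueqb}.
HB.instance Definition _ := Choice.on envel.
HB.instance Definition _ := EqQuotient.on envel.

Definition ucls (t : uterm) : envel := \pi_envel t.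

Lemma uclsP s t : ucls s = ucls t <-> ueq s t.
Proof.
split=> [/eqmodP|st]; first by move/asboolP.
by apply/eqmodP/asboolP.
Qed.

Lemma ucls_repr (u : envel) : ucls (repr u) = u.
Proof. exact: reprK. Qed.

Lemma ueq_repr t : ueq (repr (ucls t)) t.
Proof. by apply/uclsP; rewrite ucls_repr. Qed.

Definition uopp (u : envel) := ucls (UOpp (repr u)).
Definition uadd (u v : envel) := ucls (UAdd (repr u) (repr v)).
Definition umul (u v : envel) := ucls (UMul (repr u) (repr v)).
Definition uscale (a : F) (u : envel) := ucls (UScale a (repr u)).

Lemma uoppE s : uopp (ucls s) = ucls (UOpp s).
Proof. by apply/uclsP/ueq_opp/ueq_repr. Qed.

Lemma uaddE s t : uadd (ucls s) (ucls t) = ucls (UAdd s t).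
Proof. by apply/uclsP/ueq_add; apply: ueq_repr. Qed.

Lemma umulE s t : umul (ucls s) (ucls t) = ucls (UMul s t).
Proof. by apply/uclsP/ueq_mul; apply: ueq_repr. Qed.

Lemma uscaleE a s : uscale a (ucls s) = ucls (UScale a s).
Proof. by apply/uclsP/ueq_scale/ueq_repr. Qed.

Definition uE := (uoppE, uaddE, umulE, uscaleE).

Lemma ucls_ind (Q : envel -> Prop) : (forall t, Q (ucls t)) -> forall u, Q u.
Proof. by move=> Qt u; rewrite -(ucls_repr u). Qed.

Fact uaddA : associative uadd.
Proof. by do 3![elim/ucls_ind=> ?]; rewrite !uE; apply/uclsP/ueq_addA. Qed.
Fact uaddC : commutative uadd.
Proof. by do 2![elim/ucls_ind=> ?]; rewrite !uE; apply/uclsP/ueq_addC. Qed.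
Fact uadd0 : left_id (ucls UZero) uadd.
Proof. by elim/ucls_ind=> ?; rewrite !uE; apply/uclsP/ueq_add0. Qed.
Fact uaddN : left_inverse (ucls UZero) uopp uadd.
Proof. by elim/ucls_ind=> ?; rewrite !uE; apply/uclsP/ueq_addN. Qed.

HB.instance Definition _ := GRing.isZmodule.Build envel uaddA uaddC uadd0 uaddN.

Fact umulA : associative umul.
Proof. by do 3![elim/ucls_ind=> ?]; rewrite !uE; apply/uclsP/ueq_mulA. Qed.
Fact umul1l : left_id (ucls UOne) umul.
Proof. by elim/ucls_ind=> ?; rewrite !uE; apply/uclsP/ueq_mul1l. Qed.
Fact umul1r : right_id (ucls UOne) umul.
Proof. by elim/ucls_ind=> ?; rewrite !uE; apply/uclsP/ueq_mul1r. Qed.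
Fact umulDl : left_distributive umul uadd.
Proof. by do 3![elim/ucls_ind=> ?]; rewrite !uE; apply/uclsP/ueq_mulDl. Qed.
Fact umulDr : right_distributive umul uadd.
Proof. by do 3![elim/ucls_ind=> ?]; rewrite !uE; apply/uclsP/ueq_mulDr. Qed.

Section Eval.
Variables (A : algType F) (f : L -> A).

Fixpoint ueval (t : uterm) : A :=
  match t with
  | UGen x => f x
  | UZero => 0
  | UOne => 1
  | UOpp s => - ueval s
  | UAdd s s' => ueval s + ueval s'
  | UMul s s' => ueval s * ueval s'
  | UScale a s => a *: ueval s
  end.

Definition lie_morph : Prop :=
  (forall (a : F) (x y : L), f (a *: x + y) = a *: f x + f y) /\
  (forall x y : L, f (lie x y) = f x * f y - f y * f x).

Lemma ueval_eq : lie_morph -> forall s t, ueq s t -> ueval s = ueval t.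
Proof.
case=> f_lin f_lie s t; elim=> {s t} //=.
- by move=> s t u _ -> _ ->.
- by move=> s s' _ ->.
- by move=> s s' t t' _ -> _ ->.
- by move=> s s' t t' _ -> _ ->.
- by move=> a s s' _ ->.
- by move=> *; rewrite addrA.
- by move=> *; rewrite addrC.
- by move=> *; rewrite add0r.
- by move=> *; rewrite addNr.
- by move=> *; rewrite mulrA.
- by move=> *; rewrite mul1r.
- by move=> *; rewrite mulr1.
- by move=> *; rewrite mulrDl.
- by move=> *; rewrite mulrDr.
- by move=> *; rewrite scalerA.
- by move=> *; rewrite scale1r.
- by move=> *; rewrite scalerDr.
- by move=> *; rewrite scalerDl.
- by move=> *; rewrite scalerAl.
- by move=> *; rewrite scalerAr.
Qed.

(* The algebra morphism envel -> A induced by f, when f is a lie_morph. *)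
Definition envel_lift (u : envel) : A := ueval (repr u).

Lemma envel_liftE : lie_morph -> forall t, envel_lift (ucls t) = ueval t.
Proof. by move=> fP t; apply: ueval_eq (ueq_repr t). Qed.

End Eval.

Fact uone_neq0 : ucls UOne != ucls UZero.
Proof.
apply/eqP=> /uclsP /(@ueval_eq F^o (fun _ => 0)) E.
have /E : lie_morph (fun _ : L => 0 : F^o).
  by split=> *; rewrite ?scaler0 ?mulr0 ?subr0 ?addr0.
by move/eqP; rewrite oner_eq0.
Qed.

HB.instance Definition _ :=
  GRing.Zmodule_isNzRing.Build envel umulA umul1l umul1r umulDl umulDr uone_neq0.

Fact uscaleA a b u : uscale a (uscale b u) = uscale (a * b) u.
Proof. by elim/ucls_ind: u=> ?; rewrite !uE; apply/uclsP/ueq_scaleA. Qed.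
Fact uscale1 : left_id 1 uscale.
Proof. by elim/ucls_ind=> ?; rewrite !uE; apply/uclsP/ueq_scale1. Qed.
Fact uscaleDr : right_distributive uscale +%R.
Proof.
by move=> a; do 2![elim/ucls_ind=> ?]; rewrite /GRing.add /= !uE;
   apply/uclsP/ueq_scaleDr.
Qed.
Fact uscaleDl u : {morph uscale^~ u : a b / a + b}.
Proof.
move=> a b; elim/ucls_ind: u => t.
rewrite -[RHS]/(uadd (uscale a (ucls t)) (uscale b (ucls t))) !uE.
by apply/uclsP/ueq_scaleDl.
Qed.

HB.instance Definition _ :=
  GRing.Zmodule_isLmodule.Build F envel uscaleA uscale1 uscaleDr uscaleDl.

Fact uscaleAl (a : F) (u v : envel) : a *: (u * v) = (a *: u) * v.
Proof.
by elim/ucls_ind: u => s; elim/ucls_ind: v => t;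
   rewrite /GRing.mul /GRing.scale /= !uE; apply/uclsP/ueq_scaleAl.
Qed.
HB.instance Definition _ := GRing.Lmodule_isLalgebra.Build F envel uscaleAl.

Fact uscaleAr (a : F) (u v : envel) : a *: (u * v) = u * (a *: v).
Proof.
by elim/ucls_ind: u => s; elim/ucls_ind: v => t;
   rewrite /GRing.mul /GRing.scale /= !uE; apply/uclsP/ueq_scaleAr.
Qed.
HB.instance Definition _ := GRing.Lalgebra_isAlgebra.Build F envel uscaleAr.

Lemma uclsN s : ucls (UOpp s) = - ucls s.
Proof. by rewrite -uoppE. Qed.
Lemma uclsD s t : ucls (UAdd s t) = ucls s + ucls t.
Proof. by rewrite -uaddE. Qed.
Lemma uclsM s t : ucls (UMul s t) = ucls s * ucls t.
Proof. by rewrite -umulE. Qed.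
Lemma uclsZ a s : ucls (UScale a s) = a *: ucls s.
Proof. by rewrite -uscaleE. Qed.

Definition envel_gen (x : L) : envel := ucls (UGen x).

Lemma envel_gen_morph : lie_morph envel_gen.
Proof.
split=> [a x y | x y]; rewrite /envel_gen.
  by rewrite -uclsZ -uclsD; apply/uclsP; exact: ueq_gen_linear.
by rewrite -!uclsM -uclsN -uclsD; apply/uclsP; exact: ueq_gen_lie.
Qed.

End Envel.

Arguments envel {F} L.

Theorem envel_universal (F : fieldType) (L : lieAlgType F) (A : algType F)
    (f : L -> A) : lie_morph f ->
  exists2 g : {lrmorphism envel L -> A},
    (g : envel L -> A) = envel_lift f /\ (forall x, g (envel_gen x) = f x) &
    forall h : {lrmorphism envel L -> A},
      (forall x, h (envel_gen x) = f x) -> h =1 g.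
Proof.
move=> fP; pose g := envel_lift f.
have gE := envel_liftE fP.
have g_lin : linear g.
  move=> a; elim/ucls_ind=> s; elim/ucls_ind=> t.
  by rewrite -uclsZ -uclsD /g !gE.
have g_mul : monoid_morphism g.
  split; first by rewrite /g; apply: (gE (UOne L)).
  elim/ucls_ind=> s; elim/ucls_ind=> t.
  by rewrite -uclsM /g !gE.
pose gL := GRing.isLinear.Build F (envel L) A *:%R g g_lin.
pose gM := GRing.isMonoidMorphism.Build (envel L) A g g_mul.
pose gLR : {lrmorphism envel L -> A} := HB.pack g gL gM.
exists gLR; first by split=> // x; apply: gE.
move=> h hE; elim/ucls_ind=> t; rewrite /= /g gE.
elim: t => [x||| s IHs | s IHs t IHt | s IHs t IHt | a s IHs] /=.
- exact: hE.
- exact: (raddf0 h).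
- exact: (rmorph1 h).
- by rewrite uclsN raddfN /= IHs.
- by rewrite uclsD raddfD /= IHs IHt.
- by rewrite uclsM rmorphM /= IHs IHt.
- by rewrite uclsZ linearZ /= IHs.
Qed.

Section PlusMinus.
Variables (F : fieldType) (L : finLieAlgType F).
Local Open Scope classical_set_scope.

Definition liesub_gen (P : liesub L) (x : liesub_of P) : envel L :=
  envel_gen (vsval x).

Lemma liesub_gen_morph (P : liesub L) : lie_morph (@liesub_gen P).
Proof.
split=> [a x y | x y]; rewrite /liesub_gen /=.
  exact: (envel_gen_morph L).1.
exact: (envel_gen_morph L).2.
Qed.

(* U(P) inside U(L): the image of the algebra morphism U(P) -> U(L) induced by
   the inclusion of P in L, which is injective by Poincare-Birkhoff-Witt. *)
Definition envel_sub (P : liesub L) : set (envel L) :=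
  range (envel_lift (@liesub_gen P)).

Definition prod_span (A B : set (envel L)) : set (envel L) :=
  [set u | exists (n : nat) (c : 'I_n -> F) (a b : 'I_n -> envel L),
     [/\ forall i, A (a i), forall i, B (b i)
       & u = \sum_(i < n) c i *: (a i * b i)]].

Definition plus_minus_pair (P M : liesub L) : Prop :=
  (P + M)%VS <> fullv /\
  [set: envel L] = prod_span (prod_span (envel_sub P) (envel_sub M)) (envel_sub P).

Definition has_plus_minus_pair : Prop :=
  exists P M : liesub L, plus_minus_pair P M.

End PlusMinus.

Arguments has_plus_minus_pair {F} L.

(* Main.v *)
(** Both halves rest on the element [x, y]. If x and y generate L, then x, y
    and z = [x, y] form a basis. Give x and y weight 1 and z weight 2: for the
    resulting filtration of U(L), z is central up to terms of lower weight, so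
    the graded algebra is that of the Heisenberg algebra and U(L) is spanned by
    the z^l y^m x^k. Modulo lower weight,
      x (z^l y^(m+1)) - (z^l y^(m+1)) x = (m+1) z^(l+1) y^m,
    and in characteristic zero this yields z^(l+1) y^m x^k in F[x]F[y]F[x] by
    induction on the weight and on l.
    If L is not generated by two elements, then [x, y] lies in Fx + Fy for all
    x, y; hence [x, y] = lam(x) y - lam(y) x for a linear form lam. For any
    linear form th, x |-> ((lam(x), th(x)), (0, 0)) is then a representation of
    L. When th vanishes on P + M, it maps U(P)U(M)U(P) to diagonal matrices,
    but it maps some element of L to a non-diagonal one. *)
Require Import Defs.
From mathcomp Require Import all_boot all_order all_algebra.
From mathcomp Require Import boolp classical_sets zify.

Set Implicit Arguments.
Unset Strict Implicit.
Unset Printing Implicit Defensive.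

Import GRing.Theory.
Local Open Scope ring_scope.

(** * Linear spans of arbitrary subsets of an algebra *)

Section LinearSpan.
Variables (F : fieldType) (A : algType F).
Implicit Types (G H K : A -> Prop) (u v : A).

(** [A] may be infinite-dimensional, so spans are predicates rather than finite-dimensional
    subspaces, and each span argument becomes an induction on membership. *)
Inductive lspan G : A -> Prop :=
| lspan0 : lspan G 0
| lspan_gen u : G u -> lspan G u
| lspan_lin a u v : lspan G u -> lspan G v -> lspan G (a *: u + v).

Lemma lspanD G u v : lspan G u -> lspan G v -> lspan G (u + v).
Proof. by move=> Gu Gv; rewrite -[u]scale1r; apply: lspan_lin. Qed.

Lemma lspanZ G a u : lspan G u -> lspan G (a *: u).
Proof. by move=> Gu; rewrite -[_ *: _]addr0; apply: lspan_lin Gu (lspan0 _). Qed.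

Lemma lspanB G u v : lspan G u -> lspan G v -> lspan G (u - v).
Proof. by move=> Gu Gv; rewrite addrC -scaleN1r; apply: lspan_lin. Qed.

Lemma lspanMn G u n : lspan G u -> lspan G (u *+ n).
Proof. by move=> Gu; rewrite -scaler_nat; apply: lspanZ. Qed.

Lemma lspan_sub G H : (forall u, G u -> lspan H u) ->
  forall u, lspan G u -> lspan H u.
Proof.
move=> GH u; elim=> {u} [|u /GH //|a u v _ Hu _ Hv]; first exact: lspan0.
exact: lspan_lin.
Qed.

Lemma lspanM G H K :
  (forall u v, G u -> H v -> lspan K (u * v)) ->
  forall u v, lspan G u -> lspan H v -> lspan K (u * v).
Proof.
move=> GHK u v Gu; elim: Gu v => {u} [v _|u Gu v|a u u' _ IHu _ IHu' v Hv].
- by rewrite mul0r; apply: lspan0.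
- elim=> {v} [|v /GHK-/(_ u Gu) //|a v v' _ IHv _ IHv'].
    by rewrite mulr0; apply: lspan0.
  by rewrite mulrDr -scalerAr; apply: lspan_lin.
- by rewrite mulrDl -scalerAl; apply: lspan_lin; auto.
Qed.

End LinearSpan.

(** * The weight filtration and normally ordered monomials *)

Section HeisenbergFiltration.
Variables (F : fieldType) (A : algType F) (x y z : A).

Definition com (u v : A) : A := u * v - v * u.

Lemma com_mulr u v w : com u (v * w) = com u v * w + v * com u w.
Proof. by rewrite /com mulrBl mulrBr !mulrA addrA subrK. Qed.

Inductive word : nat -> A -> Prop :=
| word1 : word 0 1
| wordx n u : word n u -> word n.+1 (x * u)
| wordy n u : word n u -> word n.+1 (y * u)
| wordz n u : word n u -> word n.+2 (z * u).

Lemma wordM m n u v : word m u -> word n v -> word (m + n) (u * v).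
Proof.
elim=> {m u} [|m u _ IH|m u _ IH|m u _ IH] wv; rewrite ?mul1r // -mulrA.
- exact/wordx/IH.
- exact/wordy/IH.
- exact/wordz/IH.
Qed.

Definition filt (n : nat) : A -> Prop :=
  lspan (fun u => exists2 m, (m <= n)%N & word m u).

Lemma filt_le m n u : (m <= n)%N -> filt m u -> filt n u.
Proof.
move=> mn; apply: lspan_sub => {}u [k km wu]; apply: lspan_gen.
by exists k => //; apply: leq_trans mn.
Qed.

Lemma filtM m n u v : filt m u -> filt n v -> filt (m + n) (u * v).
Proof.
move: u v; apply: lspanM => u v [i im wu] [j jn wv]; apply: lspan_gen.
by exists (i + j)%N; [apply: leq_add | apply: wordM].
Qed.

Lemma filt_word n u : word n u -> filt n u.
Proof. by move=> wu; apply: lspan_gen; exists n. Qed.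

Lemma filt1 : filt 0 1. Proof. exact: filt_word word1. Qed.
Lemma filtx : filt 1 x.
Proof. by have := filt_word (wordx word1); rewrite mulr1. Qed.
Lemma filty : filt 1 y.
Proof. by have := filt_word (wordy word1); rewrite mulr1. Qed.
Lemma filtz : filt 2 z.
Proof. by have := filt_word (wordz word1); rewrite mulr1. Qed.

Lemma filtX d n u : filt d u -> filt (d * n) (u ^+ n).
Proof.
move=> fu; elim: n => [|n IH]; first by rewrite muln0; apply: filt1.
by rewrite exprS mulnS; apply: filtM.
Qed.

(** The products [x * z] and [y * z] have weight 3, while [comxz] and [comyz] put the commutators in
    a span of weight at most 2. *)
Let Fxyz (u : A) := lspan (fun v => v \in [:: x; y; z]) u.
Hypotheses (comxy : com x y = z).
Hypotheses (comxz : Fxyz (com x z)) (comyz : Fxyz (com y z)).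

Lemma filt2_lin u : Fxyz u -> filt 2 u.
Proof.
elim=> {u} [|u|a u v _ Fu _ Fv]; first exact: lspan0; last exact: lspan_lin.
rewrite !inE => /or3P[] /eqP->; last exact: filtz.
  exact: filt_le filtx.
exact: filt_le filty.
Qed.

(** [com u] is a derivation, and each factor [z] that it hits becomes an element of weight at most
    2, so the total weight stays within [2 * l]. *)
Lemma filt_comXz u l : Fxyz (com u z) -> filt (2 * l) (com u (z ^+ l)).
Proof.
move=> /filt2_lin fuz; elim: l => [|l IH].
  by rewrite /com mulr1 mul1r subrr; apply: lspan0.
rewrite exprS com_mulr mulnS; apply: lspanD; apply: filtM => //.
  exact/filtX/filtz.
exact: filtz.
Qed.

(** The derivation [com x] turns one factor [y] at a time into [z]; bringing that [z] to the front
    costs terms in [com y z], of weight at most [m]. At [m = 0] the truncated [m.-1] is harmless,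
    its term having multiplicity 0. *)
Lemma filt_comxYn m : filt m (com x (y ^+ m) - (z * y ^+ m.-1) *+ m).
Proof.
elim: m => [|m IH].
  by rewrite /com mulr1 mul1r mulr0n !subrr; apply: lspan0.
rewrite exprS com_mulr comxy mulrS opprD addrACA subrr add0r /=.
(* This is [y * z = z * y + com y z], applied to each of the [m] copies of [z * y ^+ m.-1]. *)
have -> : y * com x (y ^+ m) - (z * y ^+ m) *+ m =
    y * (com x (y ^+ m) - (z * y ^+ m.-1) *+ m)
    + (com y z * y ^+ m.-1) *+ m.
  rewrite [in RHS](mulrBr y (com _ _)) mulrnAr -addrA; congr (_ + _).
  case: m {IH} => [|m]; first by rewrite !mulr0n oppr0 addr0.
  by rewrite -mulNrn -mulNrn -mulrnDl /com mulrBl -!mulrA /= -exprS addKr.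
apply: lspanD; first exact: (filtM filty IH).
case: m {IH} => [|m]; first by rewrite mulr0n; apply: lspan0.
apply: lspanMn; apply: (filtM (filt2_lin comyz)).
by rewrite -[m in filt m]mul1n; apply/filtX/filty.
Qed.

Lemma filt_comx_zy l m :
  filt (2 * l + m)
    (com x (z ^+ l * y ^+ m) - (z ^+ l.+1 * y ^+ m.-1) *+ m).
Proof.
rewrite com_mulr -addrA exprSr -mulrA -mulrnAr -mulrBr.
apply: lspanD; apply: filtM.
- exact: filt_comXz.
- by rewrite -[m in filt m]mul1n; apply/filtX/filty.
- exact/filtX/filtz.
- exact: filt_comxYn.
Qed.

Definition zyx_span (n : nat) : A -> Prop :=
  lspan (fun u => exists l m k : nat,
    (2 * l + m + k <= n)%N /\ u = z ^+ l * y ^+ m * x ^+ k).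

Lemma zyx_span_mono n l m k : (2 * l + m + k <= n)%N ->
  zyx_span n (z ^+ l * y ^+ m * x ^+ k).
Proof. by move=> le_n; apply: lspan_gen; exists l, m, k. Qed.

Lemma zyx_span_le m n u : (m <= n)%N -> zyx_span m u -> zyx_span n u.
Proof.
move=> mn; apply: lspan_sub => {}u [i [j [k [le_m ->]]]].
by apply: zyx_span_mono; apply: leq_trans mn.
Qed.

Lemma zyx_span_mulz n u : zyx_span n u -> zyx_span n.+2 (z * u).
Proof.
elim=> {u} [|u [l [m [k [le_n ->]]]]|a u v _ Nu _ Nv].
- by rewrite mulr0; apply: lspan0.
- by rewrite !mulrA -exprS; apply: zyx_span_mono; lia.
- by rewrite mulrDr -scalerAr; apply: lspan_lin.
Qed.

(** Pushing [y] past [z ^+ l] leaves a commutator term of weight at most [n], which the first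
    hypothesis, supplied later by induction on the weight, puts in normal order. *)
Lemma zyx_span_muly n u : (forall v, filt n v -> zyx_span n v) ->
  zyx_span n u -> zyx_span n.+1 (y * u).
Proof.
move=> fN; elim=> {u} [|u [l [m [k [le_n ->]]]]|a u v _ Nu _ Nv].
- by rewrite mulr0; apply: lspan0.
- have -> : y * (z ^+ l * y ^+ m * x ^+ k) =
      z ^+ l * y ^+ m.+1 * x ^+ k + com y (z ^+ l) * y ^+ m * x ^+ k.
    by rewrite /com !mulrBl exprS !mulrA addrC subrK.
  apply: lspanD; first by apply: zyx_span_mono; lia.
  apply: (zyx_span_le (leqnSn n)); apply: fN; apply: (filt_le le_n).
  apply: filtM; first apply: filtM; first exact: filt_comXz.
    by rewrite -[m in filt m]mul1n; apply/filtX/filty.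
  by rewrite -[k in filt k]mul1n; apply/filtX/filtx.
- by rewrite mulrDr -scalerAr; apply: lspan_lin.
Qed.

(** Pushing [x] past [z ^+ l * y ^+ m] yields [m] copies of a normally ordered monomial of weight at
    most [n.+1], and a remainder of weight at most [n] for the first hypothesis. *)
Lemma zyx_span_mulx n u : (forall v, filt n v -> zyx_span n v) ->
  zyx_span n u -> zyx_span n.+1 (x * u).
Proof.
move=> fN; elim=> {u} [|u [l [m [k [le_n ->]]]]|a u v _ Nu _ Nv].
- by rewrite mulr0; apply: lspan0.
- have -> : x * (z ^+ l * y ^+ m * x ^+ k) =
      z ^+ l * y ^+ m * x ^+ k.+1
      + ((z ^+ l.+1 * y ^+ m.-1 * x ^+ k) *+ m
      + (com x (z ^+ l * y ^+ m) - (z ^+ l.+1 * y ^+ m.-1) *+ m) * x ^+ k).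
    rewrite mulrBl mulrnAl [X in _ + X]addrC subrK /com mulrBl exprS !mulrA.
    by rewrite addrC subrK.
  apply: lspanD; first by apply: zyx_span_mono; lia.
  apply: lspanD.
    (* At [m = 0] truncation of [m.-1] would break the weight bound, but the term has multiplicity
       0. *)
    case: m le_n => [|m] le_n; first by rewrite mulr0n; apply: lspan0.
    by apply/lspanMn/zyx_span_mono; lia.
  apply: (zyx_span_le (leqnSn n)); apply: fN; apply: (filt_le le_n).
  apply: filtM; first exact: filt_comx_zy.
  by rewrite -[k in filt k]mul1n; apply/filtX/filtx.
- by rewrite mulrDr -scalerAr; apply: lspan_lin.
Qed.

(** A word loses its first letter; the induction hypothesis at the smaller weight both orders the
    rest and serves as the hypothesis [fN] of the multiplication lemmas. *)
Lemma filt_zyx_span n u : filt n u -> zyx_span n u.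
Proof.
elim/ltn_ind: n u => n IH; apply: lspan_sub => u [m le_mn wu].
apply: (zyx_span_le le_mn).
case: wu le_mn => {m u} [|m u /filt_word fu|m u /filt_word fu|m u /filt_word fu]
    le_mn.
- by have := @zyx_span_mono 0 0 0 0 isT; rewrite !mulr1.
- by apply: zyx_span_mulx; [exact: IH | exact: IH].
- by apply: zyx_span_muly; [exact: IH | exact: IH].
- by apply: zyx_span_mulz; apply: IH => //; apply: ltnW.
Qed.

(** * From normally ordered monomials to products of powers of x, y, x *)

Definition xyx_span : A -> Prop :=
  lspan (fun u => exists i j k : nat, u = x ^+ i * y ^+ j * x ^+ k).

Lemma xyx_span_mulx u : xyx_span u -> xyx_span (x * u).
Proof.
elim=> {u} [|u [i [j [k ->]]]|a u v _ Wu _ Wv].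
- by rewrite mulr0; apply: lspan0.
- by apply: lspan_gen; exists i.+1, j, k; rewrite exprS !mulrA.
- by rewrite mulrDr -scalerAr; apply: lspan_lin.
Qed.

Hypothesis charF0 : [pchar F] =i pred0.

(** The commutator relation is solved for [z ^+ l.+1 * y ^+ m]. Of the three resulting terms, one is
    [x] times a monomial of smaller weight, one has the same weight but a smaller power of [z], and
    [r * x ^+ k] has smaller weight. *)
Lemma zyx_xyx_span n l m k : (2 * l + m + k <= n)%N ->
  xyx_span (z ^+ l * y ^+ m * x ^+ k).
Proof.
elim/ltn_ind: n l m k => n IHn l; elim: l => [|l IHl] m k le_n.
  (* [z ^+ 0] and [x ^+ 0] both reduce to 1. *)
  by apply: lspan_gen; exists 0, m, k.
pose r := com x (z ^+ l * y ^+ m.+1) - (z ^+ l.+1 * y ^+ m) *+ m.+1.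
have -> : z ^+ l.+1 * y ^+ m * x ^+ k = m.+1%:R^-1 *:
    (x * (z ^+ l * y ^+ m.+1 * x ^+ k) - z ^+ l * y ^+ m.+1 * x ^+ k.+1
     - r * x ^+ k).
  rewrite /r /com !mulrBl (exprS x k) !mulrA subKr mulrnAl.
  rewrite -scaler_nat scalerA mulVf ?scale1r //.
  by move/pcharf0P: charF0 => ->.
have n_gt0 : (n.-1 < n)%N by lia.
apply: lspanZ; apply: lspanB; first apply: lspanB.
- by apply: xyx_span_mulx; apply: (IHn n.-1) => //; lia.
- by apply: IHl; lia.
- have /filt_zyx_span : filt (2 * l + m.+1 + k) (r * x ^+ k).
    apply: filtM; first exact: filt_comx_zy.
    by rewrite -[k in filt k]mul1n; apply/filtX/filtx.
  apply: lspan_sub => u [l' [m' [k' [le' ->]]]].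
  by apply: (IHn n.-1) => //; lia.
Qed.

Lemma filt_xyx_span n u : filt n u -> xyx_span u.
Proof.
move/filt_zyx_span; apply: lspan_sub => {}u [l [m [k [le_n ->]]]].
exact: zyx_xyx_span le_n.
Qed.

End HeisenbergFiltration.

(** * Bracket identities and induction over the enveloping algebra *)

Section Envelope.
Variables (F : fieldType) (L : lieAlgType F).
Implicit Types (x y z : L) (u v : envel L).

Lemma lieDl x y z : lie (x + y) z = lie x z + lie y z.
Proof. by rewrite -[x]scale1r lie_linear_l !scale1r. Qed.

Lemma lieDr x y z : lie z (x + y) = lie z x + lie z y.
Proof. by rewrite -[x]scale1r lie_linear_r !scale1r. Qed.

Lemma lie0l x : lie 0 x = 0.
Proof. by apply: (addrI (lie 0 x)); rewrite -lieDl !addr0. Qed.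

Lemma lie0r x : lie x 0 = 0.
Proof. by apply: (addrI (lie x 0)); rewrite -lieDr !addr0. Qed.

Lemma lieZl a x y : lie (a *: x) y = a *: lie x y.
Proof. by rewrite -[a *: x]addr0 lie_linear_l lie0l addr0. Qed.

Lemma lieZr a x y : lie x (a *: y) = a *: lie x y.
Proof. by rewrite -[a *: y]addr0 lie_linear_r lie0r addr0. Qed.

Lemma lieC x y : lie y x = - lie x y.
Proof.
apply/eqP; rewrite -addr_eq0; apply/eqP.
by have := liexx (x + y); rewrite lieDl !lieDr !liexx add0r addr0 addrC.
Qed.

Lemma envel_gen0 : envel_gen (0 : L) = 0.
Proof.
apply: (addrI (envel_gen (0 : L))).
by have := (envel_gen_morph L).1 1 0 0; rewrite !scale1r !addr0 => <-.
Qed.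

Lemma envel_ind (Q : envel L -> Prop) : Q 1 -> (forall x, Q (envel_gen x)) ->
  (forall a u v, Q u -> Q v -> Q (a *: u + v)) ->
  (forall u v, Q u -> Q v -> Q (u * v)) -> forall u, Q u.
Proof.
move=> Q1 Qgen Qlin Qmul; have Q0 : Q 0.
  by rewrite -[0](addNr 1) -scaleN1r; apply: Qlin.
elim/ucls_ind; elim=> // [s IHs|s IHs t IHt|s IHs t IHt|a s IHs].
- by rewrite uclsN -[- _]addr0 -scaleN1r; apply: Qlin.
- by rewrite uclsD -[ucls s]scale1r; apply: Qlin.
- by rewrite uclsM; apply: Qmul.
- by rewrite uclsZ -[_ *: _]addr0; apply: Qlin.
Qed.

End Envelope.

(** * Generation by two elements and the resulting plus-minus pair *)

Section TwoGenerated.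
Variables (F : fieldType) (L : finLieAlgType F).
Implicit Types (x y z : L) (P M : liesub L).

Lemma lie_span2_closed x y :
  lie x y \in <<[:: x; y]>>%VS -> lie_closed <<[:: x; y]>>%VS.
Proof.
move=> xyP u v; rewrite !span_cons span_nil addv0.
rewrite !span_cons span_nil addv0 in xyP.
move=> /memv_addP[_ /vlineP[a ->] [_ /vlineP[b ->] ->]].
move=> /memv_addP[_ /vlineP[c ->] [_ /vlineP[d ->] ->]].
rewrite !(lieDl, lieDr, lieZl, lieZr, liexx) (lieC x y) !scaler0 add0r addr0.
by rewrite rpredD ?rpredZ ?rpredN.
Qed.

(** Otherwise the span of [x] and [y] would be a subalgebra containing both, hence all of [L],
    although its dimension is at most 2. *)
Lemma lie_generated2_notin x y : (2 < \dim {: L})%N ->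
  lie_generated_by [:: x; y] -> lie x y \notin <<[:: x; y]>>%VS.
Proof.
move=> dimL gen_xy; apply/negP => /lie_span2_closed xy_closed.
have /= xy_full : <<[:: x; y]>>%VS = fullv.
  by apply: (gen_xy (LieSub xy_closed)) => u; apply: memv_span.
by have := dim_span [:: x; y]; rewrite xy_full leqNgt dimL.
Qed.

(** A linear relation between [x] and [y] would make [lie x y] vanish. *)
Lemma lie_free3 x y : lie x y \notin <<[:: x; y]>>%VS ->
  free [:: lie x y; x; y].
Proof.
move=> xyN; rewrite free_cons xyN free_cons span_seq1 seq1_free /=.
apply/andP; split; apply: contra xyN.
  by case/vlineP=> a ->; rewrite lieZl liexx scaler0 mem0v.
by move/eqP->; rewrite lie0r mem0v.
Qed.

Lemma lie_span3_full x y : \dim {: L} = 3%N ->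
  lie x y \notin <<[:: x; y]>>%VS -> <<[:: lie x y; x; y]>>%VS = fullv.
Proof.
move=> dimL /lie_free3 xy_free; apply/eqP; rewrite eqEdim subvf /=.
by rewrite (eqP xy_free) dimL.
Qed.

Lemma lie_notin_generated2 x y : \dim {: L} = 3%N ->
  lie x y \notin <<[:: x; y]>>%VS -> lie_generated_by [:: x; y].
Proof.
move=> dimL xyN S xyS; apply/eqP; rewrite eqEsubv subvf /=.
have [xS yS] : x \in (S : {vspace L}) /\ y \in (S : {vspace L}).
  by split; apply: xyS; rewrite !inE eqxx ?orbT.
rewrite -(lie_span3_full dimL xyN); apply/span_subvP => u.
by rewrite !inE => /or3P[] /eqP-> //; apply: liesub_closed.
Qed.

Lemma envel_gen_span (X : seq L) v : v \in <<X>>%VS ->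
  lspan (fun u => u \in [seq envel_gen w | w <- X]) (envel_gen v).
Proof.
elim: X v => [|w X IH] v.
  rewrite span_nil memv0 => /eqP->; rewrite envel_gen0; exact: lspan0.
rewrite span_cons => /memv_addP[_ /vlineP[a ->] [v' /IH Xv' ->]].
rewrite (envel_gen_morph L).1; apply: lspan_lin.
  by apply: lspan_gen; rewrite mem_head.
apply: lspan_sub Xv' => u Xu; apply: lspan_gen.
by rewrite /= inE Xu orbT.
Qed.

Lemma prod_span_lspan (A B : set (envel L)) u :
  lspan (fun v => exists a b, [/\ A a, B b & v = a * b]) u -> prod_span A B u.
Proof.
elim=> {u} [|u [a [b [Aa Bb ->]]]|c u v _ [m [c1 [a1 [b1 [A1 B1 ->]]]]] _].
- exists 0%N, (fun=> 0), (fun=> 0), (fun=> 0).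
  by split=> [[]|[]|] //; rewrite big_ord0.
- exists 1%N, (fun=> 1), (fun=> a), (fun=> b).
  by split=> //; rewrite big_ord1 scale1r.
- case=> n [c2 [a2 [b2 [A2 B2 ->]]]].
  (* The sum of two combinations is indexed by the concatenation of their families; the scalar [c]
     is absorbed into the first coefficients. *)
  pose glue T (f : 'I_m -> T) (g : 'I_n -> T) (i : 'I_(m + n)) :=
    match split i with inl j => f j | inr j => g j end.
  exists (m + n)%N, (glue _ (fun i => c * c1 i) c2), (glue _ a1 a2),
    (glue _ b1 b2); split.
  + by move=> i; rewrite /glue; case: split.
  + by move=> i; rewrite /glue; case: split.
  + rewrite big_split_ord scaler_sumr /=; congr (_ + _); apply: eq_bigr => i _.
      by rewrite /glue (unsplitK (inl _ i)) scalerA.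
    by rewrite /glue (unsplitK (inr _ i)).
Qed.

(** The preimage is the same power of the generator of U(Fx); the universal property makes the lift
    a morphism, so it commutes with powers. *)
Lemma envel_sub_lineX x n : envel_sub (lie_line x) (envel_gen x ^+ n).
Proof.
pose x' : liesub_of (lie_line x) := Subvs (memv_line x).
have [g [gE g_gen] _] := envel_universal (liesub_gen_morph (lie_line x)).
by exists (envel_gen x' ^+ n) => //; rewrite -gE rmorphXn /= g_gen.
Qed.

Lemma plus_minus_pair_line x y : [pchar F] =i pred0 -> \dim {: L} = 3%N ->
  lie_generated_by [:: x; y] -> plus_minus_pair (lie_line x) (lie_line y).
Proof.
move=> charF0 dimL gen_xy; split.
  move=> /(congr1 (@dimv _ _)); rewrite dimL => dim_xy.
  (* The dimension of a line is the boolean [x != 0] read as a number, so the sum has dimension at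
     most 2. *)
  have := (dimv_add_leqif <[x]> <[y]>).1.
  by rewrite dim_xy !dim_vline; do 2!case: (_ != 0).
have xyN : lie x y \notin <<[:: x; y]>>%VS.
  by apply: lie_generated2_notin gen_xy; rewrite dimL.
pose X := envel_gen x; pose Y := envel_gen y; pose Z := envel_gen (lie x y).
have spanXYZ v : lspan (fun u => u \in [:: X; Y; Z]) (envel_gen v).
  have := @envel_gen_span [:: lie x y; x; y] v.
  rewrite (lie_span3_full dimL xyN) memvf => /(_ isT).
  apply: lspan_sub => u; rewrite !inE => Xu; apply: lspan_gen.
  by rewrite !inE; case/or3P: Xu => ->; rewrite ?orbT.
have comE (v w : L) : com (envel_gen v) (envel_gen w) = envel_gen (lie v w).
  exact: esym ((envel_gen_morph L).2 v w).
apply/seteqP; split=> // u _.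
(* The filtration exhausts U(L): generators lie in step 2, and the steps are compatible with sums
   and products. *)
have [n fu] : exists n, filt X Y Z n u.
  elim/envel_ind: u => [|v|a u v [m fu] [n fv]|u v [m fu] [n fv]].
  - by exists 0%N; apply: filt1.
  - by exists 2; apply: filt2_lin.
  - exists (maxn m n); apply: lspan_lin.
      exact: filt_le (leq_maxl _ _) fu.
    exact: filt_le (leq_maxr _ _) fv.
  - by exists (m + n)%N; apply: filtM.
have Wu : xyx_span X Y u by apply: filt_xyx_span fu => //; rewrite comE.
apply: prod_span_lspan; apply: lspan_sub Wu.
move=> {u fu} _ [i [j [k ->]]]; apply: lspan_gen.
exists (X ^+ i * Y ^+ j), (X ^+ k); split=> //; last exact: envel_sub_lineX.
apply: prod_span_lspan; apply: lspan_gen.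
by exists (X ^+ i), (Y ^+ j); split=> //; apply: envel_sub_lineX.
Qed.

Lemma span_linear_ind (X : seq L) (Q : L -> Prop) : Q 0 ->
  (forall a u v, Q u -> Q v -> Q (a *: u + v)) -> {in X, forall u, Q u} ->
  {in <<X>>%VS, forall u, Q u}.
Proof.
move=> Q0 Qlin; elim: X => [|w X IH] QX v.
  by rewrite span_nil memv0 => /eqP->.
rewrite span_cons => /memv_addP[_ /vlineP[a ->] [v' Xv' ->]].
apply: Qlin; first exact/QX/mem_head.
by apply: IH Xv' => u Xu; apply: QX; rewrite inE Xu orbT.
Qed.

(** * Brackets determined by a linear form *)

Hypothesis lie_in_span2 : forall x y, lie x y \in <<[:: x; y]>>%VS.

Lemma lie_span2_coef x y : exists a b, lie x y = a *: x + b *: y.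
Proof.
have := lie_in_span2 x y; rewrite !span_cons span_nil addv0.
by case/memv_addP=> _ /vlineP[a ->] [_ /vlineP[b ->] ->]; exists a, b.
Qed.

(* Compare the coefficients of v and w in [u, v + w]. *)
Lemma lie_span2_coef_eq (u v w : L) (a b c d : F) : free [:: u; v; w] ->
  lie u v = a *: u + b *: v -> lie u w = c *: u + d *: w -> b = d.
Proof.
move=> free_uvw uv uw; have [p [q]] := lie_span2_coef u (v + w).
rewrite lieDr uv uw => E.
pose k := [ffun i : 'I_3 => [:: a + c - p; b - q; d - q]`_i].
have/freeP/(_ k) free_k := free_uvw.
have k0 i : k i = 0.
  apply: free_k; rewrite !big_ord_recl big_ord0 !ffunE /= addr0.
  rewrite !scalerBl scalerDl [X in _ + X]addrACA -opprD addrACA -opprD.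
  by rewrite -scalerDr [X in X - _]addrACA E subrr.
have := k0 1; have := k0 (inord 2); rewrite !ffunE inordK //=.
by move/eqP; rewrite subr_eq0 => /eqP-> /eqP; rewrite subr_eq0 => /eqP.
Qed.

(** For a basis vector [u], [lie_span2_coef_eq] gives the same coefficient of [v] in [lie u v] for
    both other basis vectors [v]. This common value defines the form on the basis, and bilinearity
    does the rest. *)
Lemma lie_linear_form : \dim {: L} = 3%N ->
  exists lam : L -> F, (forall a x y, lam (a *: x + y) = a * lam x + lam y) /\
    forall x y, lie x y = lam x *: y - lam y *: x.
Proof.
move=> dimL.
have [e0 [e1 [e2 e_basis]]] : exists e0 e1 e2 : L, basis_of fullv [:: e0; e1; e2].
  have: basis_of fullv (vbasis {:L}) := vbasisP _.
  have: size (vbasis {:L}) = 3%N by rewrite size_tuple dimL.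
  by case: (tval _) => [|e0 [|e1 [|e2 [|]]]] // _ ?; exists e0, e1, e2.
have e_span : <<[:: e0; e1; e2]>>%VS = fullv by apply/eqP; case/andP: e_basis.
have e_free := basis_free e_basis.
have [a01 [b01 E01]] := lie_span2_coef e0 e1.
have [a02 [b02 E02]] := lie_span2_coef e0 e2.
have [a12 [b12 E12]] := lie_span2_coef e1 e2.
have E10 : lie e1 e0 = - b01 *: e1 + - a01 *: e0.
  by rewrite lieC E01 opprD addrC !scaleNr.
have E20 : lie e2 e0 = - b02 *: e2 + - a02 *: e0.
  by rewrite lieC E02 opprD addrC !scaleNr.
have E21 : lie e2 e1 = - b12 *: e2 + - a12 *: e1.
  by rewrite lieC E12 opprD addrC !scaleNr.
have eq0 : b01 = b02 by apply: lie_span2_coef_eq E01 E02.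
have eq1 : - a01 = b12.
  apply: lie_span2_coef_eq E10 E12.
  by rewrite (perm_free (permEl (perm_catCA [:: e1] [:: e0] [:: e2]))).
have eq2 : - a02 = - a12.
  apply: lie_span2_coef_eq E20 E21.
  by rewrite (perm_free (permEl (perm_catC [:: e2] [:: e0; e1]))).
pose e : 3.-tuple L := [tuple e0; e1; e2].
pose l : 3.-tuple F := [tuple b01; b12; - a02].
pose lam v := \sum_(i < 3) coord e i v * l`_i.
have lam_lin a x y : lam (a *: x + y) = a * lam x + lam y.
  rewrite /lam mulr_sumr -big_split /=; apply: eq_bigr => i _.
  by rewrite linearP /= mulrDl mulrA.
have lam_e (i : 'I_3) : lam e`_i = l`_i.
  rewrite /lam (bigD1 i) //= coord_free // eqxx mul1r big1 ?addr0 // => j ji.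
  by rewrite coord_free // eq_sym (negPf ji) mul0r.
have lam0 : lam e0 = b01 := lam_e 0.
have lam1 : lam e1 = b12 := lam_e 1.
have lam2 : lam e2 = - a02 := lam_e (Ordinal (isT : (2 < 3)%N)).
exists lam; split=> [|x y]; first exact: lam_lin.
pose Q x y := lie x y = lam x *: y - lam y *: x.
have lam00 : lam 0 = 0.
  by apply: (addrI (lam 0)); rewrite -{1}[lam 0]mul1r -lam_lin scale1r !addr0.
have QC u v : Q u v -> Q v u by rewrite /Q (lieC u v) => ->; rewrite opprB.
(* Linear extension in the first argument; together with the symmetry [QC] it serves for both
   arguments. *)
have Qx v : {in [:: e0; e1; e2], forall u, Q u v} -> forall u, Q u v.
  move=> Qev u; have: u \in <<[:: e0; e1; e2]>>%VS by rewrite e_span memvf.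
  move: u; apply: (@span_linear_ind _ (Q^~ v)) => // [|a u w Qu Qw].
    by rewrite /Q lie0l lam00 scale0r scaler0 subrr.
  rewrite /Q lie_linear_l Qu Qw lam_lin scalerBr !scalerDl !scalerDr opprD.
  by rewrite addrACA !scalerA [a * lam v]mulrC.
have Qd w : Q w w by rewrite /Q liexx subrr.
have Q01 : Q e0 e1 by rewrite /Q lam0 lam1 E01 -eq1 scaleNr opprK addrC.
have Q02 : Q e0 e2 by rewrite /Q lam0 lam2 E02 eq0 scaleNr opprK addrC.
have Q12 : Q e1 e2 by rewrite /Q lam1 lam2 E12 eq2 scaleNr opprK addrC.
apply: (Qx y) => u ue; apply: (QC); apply: (Qx u) => v ve.
by move: ue ve; rewrite !inE => /or3P[] /eqP-> /or3P[] /eqP->; auto.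
Qed.

End TwoGenerated.

(** * The two-dimensional representation and diagonal matrices *)

Section UpperTriangularRepresentation.
Variables (F : fieldType) (L : finLieAlgType F).
Implicit Types (x y : L) (P M : liesub L) (S : {vspace L}).

(** The form is the first coordinate of the projection along [S] onto a nonzero complement. *)
Lemma exists_linear_form_vanishing S : S <> fullv ->
  exists2 th : L -> F, (forall a x y, th (a *: x + y) = a * th x + th y) &
    {in S, forall x, th x = 0} /\ exists x, th x <> 0.
Proof.
move=> S_proper; pose T := (S^C)%VS.
have T_gt0 : (0 < \dim T)%N.
  rewrite lt0n dimv_eq0; apply/eqP => T0; apply: S_proper.
  by rewrite -(addv_complf S) -/T T0 addv0.
have ST0 : (S :&: T = 0)%VS := capv_compl S.
have TS0 : (T :&: S = 0)%VS by rewrite capvC.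
pose i := Ordinal T_gt0.
exists (fun x => coord (vbasis T) i (daddv_pi T S x)).
  by move=> a x y; rewrite !linearP.
split=> [x xS|].
  have := daddv_pi_add TS0 (subvP (addvSr T S) x xS).
  by rewrite (daddv_pi_id ST0 xS) -[RHS]add0r => /addIr->; rewrite linear0.
exists (vbasis T)`_i; rewrite daddv_pi_id ?vbasis_mem ?mem_nth ?size_tuple //.
rewrite coord_free ?(basis_free (vbasisP T)) // eqxx.
by apply/eqP/oner_neq0.
Qed.

Variables (lam th : L -> F).
Hypothesis lam_linear : forall a x y, lam (a *: x + y) = a * lam x + lam y.
Hypothesis th_linear : forall a x y, th (a *: x + y) = a * th x + th y.
Hypothesis lie_lam : forall x y, lie x y = lam x *: y - lam y *: x.

Definition tri_rep x : 'M[F]_2 :=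
  \matrix_(i, j) if i == 0 then if j == 0 then lam x else th x else 0.

(** Any linear form [f] takes [lie x y] to [lam x * f y - lam y * f x]. For [f = th] this is the
    upper right entry of the matrix commutator, and for [f = lam] it is the upper left one, which is
    0. *)
Lemma tri_rep_morph : lie_morph tri_rep.
Proof.
have lieE f : (forall a x y, f (a *: x + y) = a * f x + f y) ->
    forall x y, f (lie x y) = lam x * f y - lam y * f x.
  move=> f_lin x y; have f0 : f 0 = 0.
    by apply: (addrI (f 0)); have := f_lin 1 0 0; rewrite scale1r mul1r !addr0.
  by rewrite lie_lam -scaleNr -[- lam y *: x]addr0 !f_lin f0 addr0 mulNr.
split=> [a x y|x y]; apply/matrixP => i j; rewrite !mxE.
  by case: ifP => _; rewrite ?mulr0 ?addr0 //; case: ifP.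
rewrite !big_ord_recl !big_ord0 !mxE /= !addr0.
case: ifP => _; last by rewrite !mul0r subrr.
by case: ifP => _; rewrite lieE // ?mulr0 ?addr0 // ![th _ * 0]mulr0 !addr0.
Qed.

Definition diag2 (m : 'M[F]_2) : Prop := m 0 1 = 0 /\ m 1 0 = 0.

Lemma diag2_lin a m n : diag2 m -> diag2 n -> diag2 (a *: m + n).
Proof.
by case=> m01 m10 [n01 n10]; split; rewrite !mxE ?m01 ?m10 ?n01 ?n10 mulr0 addr0.
Qed.

Lemma diag2M m n : diag2 m -> diag2 n -> diag2 (m * n).
Proof.
case=> m01 m10 [n01 n10]; split; rewrite !mxE !big_ord_recl big_ord0.
  by rewrite n01 (_ : lift _ _ = 1) ?m01 ?mulr0 ?mul0r ?addr0 //; apply: val_inj.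
by rewrite m10 (_ : lift _ _ = 1) ?n10 ?mulr0 ?mul0r ?addr0 //; apply: val_inj.
Qed.

Variable g : {lrmorphism envel L -> 'M[F]_2}.
Hypothesis g_gen : forall x, g (envel_gen x) = tri_rep x.

(** Generators from [P] have diagonal images because their off-diagonal entry is [th], and diagonal
    matrices form a subalgebra. *)
Lemma diag2_envel_sub P : {in (P : {vspace L}), forall x, th x = 0} ->
  forall u, envel_sub P u -> diag2 (g u).
Proof.
move=> thP _ [u _ <-].
have [h [<- h_gen] _] := envel_universal (liesub_gen_morph P).
elim/envel_ind: u => [|x|a u v Du Dv|u v Du Dv].
- by rewrite !rmorph1; split; rewrite mxE.
- by rewrite h_gen g_gen; split; rewrite mxE //= thP // subvsP.
- by rewrite !linearP; apply: diag2_lin.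
- by rewrite !rmorphM; apply: diag2M.
Qed.

Lemma diag2_prod_span (A B : set (envel L)) :
  (forall u, A u -> diag2 (g u)) -> (forall u, B u -> diag2 (g u)) ->
  forall u, prod_span A B u -> diag2 (g u).
Proof.
move=> DA DB _ [n [c [a [b [Aa Bb ->]]]]].
rewrite linear_sum; apply: (big_ind (fun m => diag2 m)).
- by split; rewrite mxE.
- by move=> m m' Dm Dm'; rewrite -[m]scale1r; apply: diag2_lin.
- move=> i _; rewrite -[_ *: _]addr0 linearP linear0; apply: diag2_lin.
    by rewrite rmorphM; apply: diag2M; [apply: DA | apply: DB].
  by split; rewrite mxE.
Qed.

End UpperTriangularRepresentation.

Theorem theorem2p2 (F : fieldType) (charF0 : [pchar F] =i pred0)
    (L : finLieAlgType F) (dimL : \dim {: L} = 3%N) :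
  (has_plus_minus_pair L <-> exists x y : L, lie_generated_by [:: x; y]) /\
  (forall x y : L, lie_generated_by [:: x; y] ->
     plus_minus_pair (lie_line x) (lie_line y)).
Proof.
have pair x y := @plus_minus_pair_line F L x y charF0 dimL.
split=> //; split=> [[P [M [PM_proper UE]]]|[x [y /pair xy_pair]]]; last first.
  by exists (lie_line x), (lie_line y).
apply: contrapT => not_gen2.
have lie_in_span2 (x y : L) : lie x y \in <<[:: x; y]>>%VS.
  apply: contrapT => /negP xyN; apply: not_gen2; exists x, y.
  exact: lie_notin_generated2.
have [lam [lam_lin lie_lam]] := lie_linear_form lie_in_span2 dimL.
have [th th_lin [thPM [w th_w]]] := exists_linear_form_vanishing PM_proper.
have [g [_ g_gen] _] :=
  envel_universal (tri_rep_morph lam_lin th_lin lie_lam).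
have thP : {in (P : {vspace L}), forall x, th x = 0}.
  by move=> x xP; apply: thPM; apply: subvP (addvSl _ _) x xP.
have thM : {in (M : {vspace L}), forall x, th x = 0}.
  by move=> x xM; apply: thPM; apply: subvP (addvSr _ _) x xM.
have DP := diag2_envel_sub g_gen thP; have DM := diag2_envel_sub g_gen thM.
(* The image of [w] would be diagonal, yet its upper right entry is [th w], which is nonzero. *)
have: [set: envel L]%classic (envel_gen w) by [].
rewrite UE => /(diag2_prod_span (diag2_prod_span DP DM) DP)[].
by rewrite g_gen mxE.
Qed.
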